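(* Let $\eta>0$ and let $\theta^\star>0$ be the optimal value of $\theta$ in the worst-case portfolio selection with constant mean $$\inf_{\theta>0}\ \inf_{\mathbf a:\,(\theta,\mathbf a)\in\mathcal D}\ \mathcal L^{GX}(\theta,\mathbf a),$$ i.e. a value of $\theta$, with $(\theta,\mathbf a^\star(\theta))\in\mathcal D$, at which the outer infimum is attained. Then $$R(\theta^\star)=\eta,\qquad\text{where}\qquad R(\theta)=\frac12\left(\frac{\Gamma^{GX}(\theta,\gamma)}{\gamma}-1-\ln\frac{\Gamma^{GX}(\theta,\gamma)}{\gamma}\right).$$
   Context: Let $n\ge1$, $\boldsymbol\mu\in\mathbb R^n$, $\Sigma\in\mathbb R^{n\times n}$ symmetric positive definite, $\gamma>0$, and let $\mathbf X\sim N(\boldsymbol\mu,\Sigma)$ under the nominal model, with expectation $\mathbb E$. Let $\mathbf 1\in\mathbb R^n$ be the all-ones vector and $\mathcal A=\{\mathbf a\in\mathbb R^n:\mathbf a^T\mathbf 1=1\}$ the set of portfolios. Measure of risk in the mean-variance problem with constant mean: $V^{GX}_{\mathbf a}(\mathbf X)=\frac\gamma2\,\mathbf a^T(\mathbf X-\boldsymbol\mu)(\mathbf X-\boldsymbol\mu)^T\mathbf a-\mathbf a^T\boldsymbol\mu$. Domain: $\mathcal D=\{(\theta,\mathbf a):\theta>0,\ \mathbf a\in\mathcal A,\ \theta\,\mathbf a^T\Sigma\,\mathbf a<1/\gamma\}$. (The infimum over an empty set is $+\infty$.) Lagrangian at the optimal change of measure: $\mathcal L^{GX}(\theta,\mathbf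 a)=\frac1\theta\ln\mathbb E[\exp(\theta V^{GX}_{\mathbf a}(\mathbf X))]+\frac\eta\theta$. For each $\theta>0$ for which some $(\theta,\mathbf a)\in\mathcal D$ exists, $\mathbf a^\star(\theta)$ denotes the (unique) minimiser of $\mathbf a\mapsto\frac1\theta\ln\mathbb E[\exp(\theta V^{GX}_{\mathbf a}(\mathbf X))]$ over $\{\mathbf a:(\theta,\mathbf a)\in\mathcal D\}$. Constants: $A=\mathbf 1^T\Sigma^{-1}\boldsymbol\mu$, $B=\boldsymbol\mu^T\Sigma^{-1}\boldsymbol\mu$, $C=\mathbf 1^T\Sigma^{-1}\mathbf 1$, $D=BC-A^2$, and $$\Gamma^{GX}(\theta,\gamma)=\frac{\gamma C+\sqrt{\gamma^2C^2+4\theta\gamma(C-\theta\gamma)D}}{2(C-\theta\gamma)}.$$ The function $R(\theta)$ is the relative entropy $\mathbb E[m\ln m]$ of the worst-case change of measure $m=\exp(\theta V^{GX}_{\mathbf a^\star(\theta)}(\mathbf X))/\mathbb E[\exp(\theta V^{GX}_{\mathbf a^\star(\theta)}(\mathbf X))]$. *)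

(* Defs.v *)
From HB Require Import structures.
From mathcomp Require Import all_boot all_order all_algebra.
From mathcomp Require Import all_classical all_reals all_analysis.

Set Implicit Arguments.
Unset Strict Implicit.
Unset Printing Implicit Defensive.

Import Order.TTheory GRing.Theory Num.Theory.
Import numFieldNormedType.Exports.

Local Open Scope classical_set_scope.
Local Open Scope ring_scope.

Definition scalar_of {R : realType} (M : 'M[R]_1) : R := M 0 0.

Definition ones {R : realType} {n : nat} : 'cV[R]_n := const_mx 1.

Definition symmetric_posdef {R : realType} {n : nat} (Sigma : 'M[R]_n) : Prop :=
  Sigma^T = Sigma /\
  forall a : 'cV[R]_n, a != 0 -> 0 < scalar_of (a^T *m Sigma *m a).

(* X ~ N(mu, Sigma), for Sigma positive definite: every linear form a^T X is
   N(a^T mu, a^T Sigma a).  The form a = 0 carries no information (a^T X is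
   identically 0) and is left out because normal_prob m 0 is not a Dirac mass.
   The second parameter of normal_prob is the standard deviation. *)
Definition gaussian_vector {d : measure_display} {T : measurableType d}
    {R : realType} (P : probability T R) {n : nat} (X : T -> 'cV[R]_n)
    (mu : 'cV[R]_n) (Sigma : 'M[R]_n) : Prop :=
  (forall i : 'I_n, measurable_fun [set: T] (fun w => X w i 0)) /\
  forall a : 'cV[R]_n, a != 0 ->
  forall B : set R, measurable B ->
    P ((fun w => scalar_of (a^T *m X w)) @^-1` B) =
    normal_prob (scalar_of (a^T *m mu))
                (Num.sqrt (scalar_of (a^T *m Sigma *m a))) B.

Definition portfolios {R : realType} {n : nat} : set 'cV[R]_n :=
  [set a | scalar_of (a^T *m ones) = 1].

Definition domain {R : realType} {n : nat} (gamma : R) (Sigma : 'M[R]_n) :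
    set (R * 'cV[R]_n) :=
  [set p | [/\ 0 < p.1, portfolios p.2 &
               p.1 * scalar_of (p.2^T *m Sigma *m p.2) < 1 / gamma]].

Definition VGX {R : realType} {n : nat} (gamma : R) (mu : 'cV[R]_n)
    (a x : 'cV[R]_n) : R :=
  gamma / 2 * scalar_of (a^T *m (x - mu) *m (x - mu)^T *m a)
  - scalar_of (a^T *m mu).

Definition exp_moment {d : measure_display} {T : measurableType d}
    {R : realType} (P : probability T R) {n : nat} (X : T -> 'cV[R]_n)
    (mu : 'cV[R]_n) (gamma theta : R) (a : 'cV[R]_n) : \bar R :=
  'E_P[fun w => expR (theta * VGX gamma mu a (X w))].

Definition entropic_risk {d : measure_display} {T : measurableType d}
    {R : realType} (P : probability T R) {n : nat} (X : T -> 'cV[R]_n)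
    (mu : 'cV[R]_n) (gamma theta : R) (a : 'cV[R]_n) : \bar R :=
  ((1 / theta)%:E * lne (exp_moment P X mu gamma theta a))%E.

Definition LGX {d : measure_display} {T : measurableType d}
    {R : realType} (P : probability T R) {n : nat} (X : T -> 'cV[R]_n)
    (mu : 'cV[R]_n) (gamma eta theta : R) (a : 'cV[R]_n) : \bar R :=
  (entropic_risk P X mu gamma theta a + (eta / theta)%:E)%E.

Definition is_minimiser {d : measure_display} {T : measurableType d}
    {R : realType} (P : probability T R) {n : nat} (X : T -> 'cV[R]_n)
    (mu : 'cV[R]_n) (Sigma : 'M[R]_n) (gamma theta : R) (a : 'cV[R]_n) : Prop :=
  domain gamma Sigma (theta, a) /\
  forall b : 'cV[R]_n, domain gamma Sigma (theta, b) ->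
    (entropic_risk P X mu gamma theta a <=
     entropic_risk P X mu gamma theta b)%E.

(* The default value 0 is not a portfolio: it is returned exactly when there
   is no minimiser. *)
Definition astar {d : measure_display} {T : measurableType d}
    {R : realType} (P : probability T R) {n : nat} (X : T -> 'cV[R]_n)
    (mu : 'cV[R]_n) (Sigma : 'M[R]_n) (gamma theta : R) : 'cV[R]_n :=
  xget 0 [set a | is_minimiser P X mu Sigma gamma theta a].

Definition inner_value {d : measure_display} {T : measurableType d}
    {R : realType} (P : probability T R) {n : nat} (X : T -> 'cV[R]_n)
    (mu : 'cV[R]_n) (Sigma : 'M[R]_n) (gamma eta theta : R) : \bar R :=
  ereal_inf [set LGX P X mu gamma eta theta a
            | a in [set a | domain gamma Sigma (theta, a)]].

Definition outer_value {d : measure_display} {T : measurableType d}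
    {R : realType} (P : probability T R) {n : nat} (X : T -> 'cV[R]_n)
    (mu : 'cV[R]_n) (Sigma : 'M[R]_n) (gamma eta : R) : \bar R :=
  ereal_inf [set inner_value P X mu Sigma gamma eta theta
            | theta in [set theta : R | 0 < theta]].

(* fine loses nothing for (theta, a) in the domain, where the exponential
   moment is finite. *)
Definition change_of_measure {d : measure_display} {T : measurableType d}
    {R : realType} (P : probability T R) {n : nat} (X : T -> 'cV[R]_n)
    (mu : 'cV[R]_n) (gamma theta : R) (a : 'cV[R]_n) (w : T) : R :=
  expR (theta * VGX gamma mu a (X w)) / fine (exp_moment P X mu gamma theta a).

Definition relative_entropy {d : measure_display} {T : measurableType d}
    {R : realType} (P : probability T R) (m : T -> R) : \bar R :=
  'E_P[fun w => m w * ln (m w)].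

Definition worst_case_entropy {d : measure_display} {T : measurableType d}
    {R : realType} (P : probability T R) {n : nat} (X : T -> 'cV[R]_n)
    (mu : 'cV[R]_n) (Sigma : 'M[R]_n) (gamma theta : R) : \bar R :=
  relative_entropy P (change_of_measure P X mu gamma theta
                        (astar P X mu Sigma gamma theta)).

Definition constA {R : realType} {n : nat} (mu : 'cV[R]_n) (Sigma : 'M[R]_n) : R :=
  scalar_of (ones^T *m invmx Sigma *m mu).

Definition constB {R : realType} {n : nat} (mu : 'cV[R]_n) (Sigma : 'M[R]_n) : R :=
  scalar_of (mu^T *m invmx Sigma *m mu).

Definition constC {R : realType} {n : nat} (Sigma : 'M[R]_n) : R :=
  scalar_of (ones^T *m invmx Sigma *m ones).

Definition constD {R : realType} {n : nat} (mu : 'cV[R]_n) (Sigma : 'M[R]_n) : R :=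
  constB mu Sigma * constC Sigma - constA mu Sigma ^+ 2.

Definition GammaGX {R : realType} {n : nat} (mu : 'cV[R]_n) (Sigma : 'M[R]_n)
    (theta gamma : R) : R :=
  let C := constC Sigma in
  let D := constD mu Sigma in
  (gamma * C + Num.sqrt (gamma ^+ 2 * C ^+ 2
                         + 4 * theta * gamma * (C - theta * gamma) * D))
  / (2 * (C - theta * gamma)).

(* Main.v *)
Require Import Defs.
From HB Require Import structures.
From mathcomp Require Import all_boot all_order all_algebra.
From mathcomp Require Import all_classical all_reals all_analysis.
From mathcomp Require Import measurable_realfun ring lra.

Set Implicit Arguments.
Unset Strict Implicit.
Unset Printing Implicit Defensive.

Import Order.TTheory GRing.Theory Num.Theory.
Import numFieldNormedType.Exports.

Local Open Scope classical_set_scope.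
Local Open Scope ring_scope.

(** For a portfolio a let m = a^T mu, v = a^T Sigma a and
    u = 1 - theta gamma v.  Tilting the Gaussian law N(m, v) of a^T X by
    exp (theta gamma (x - m)^2 / 2) gives N(m, v / u) up to the factor u^(-1/2);
    hence the entropic risk is - m - ln u / (2 theta), and the relative entropy
    of the tilt is (1/u - 1 - ln (1/u)) / 2.

    The minimiser over a is a = Gamma^-1 Sigma^-1 (mu + k 1), with k chosen so
    that a^T 1 = 1: the quadratic equation solved by Gamma says exactly that
    u = gamma / Gamma, and ln x <= x - 1 bounds the excess risk of any other b
    below by Gamma (b - a)^T Sigma (b - a) / 2.

    At thetastar no envelope theorem is needed: with a fixed at the minimiser,
    (theta, a) stays in the domain for theta near thetastar, so the Lagrangian
    at (theta, a) is minimal at thetastar, and its stationarity is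
    R(thetastar) = eta. *)

(** * Exponential and Gaussian integrals *)

Lemma integral0y_expRN (R : realType) :
  (\int[lebesgue_measure]_(x in `[0%R, +oo[) (expR (- x))%:E = 1 :> \bar R)%E.
Proof.
have dE (x : R) : is_derive x 1 (fun y => - expR (- y)) (expR (- x)).
  by apply: is_derive_eq; rewrite mulrN1 opprK.
rewrite (@ge0_continuous_FTC2y _ (fun x => expR (- x))
  (fun x => - expR (- x)) 0 0).
- by rewrite oppr0 expR0 sub0e EFinN oppeK.
- by move=> x _; exact: expR_ge0.
- apply: continuous_subspaceT => x.
  by apply: differentiable_continuous; exact/derivable1_diffP.
- by rewrite -oppr0; apply: cvgN; exact: cvgr_expR.
- by move=> x _; exact: (@ex_derive _ _ _ _ _ _ _ (dE x)).
- apply: cvg_at_right_filter.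
  have /derivable1_diffP/differentiable_continuous :=
    @ex_derive _ _ _ _ _ _ _ (dE 0).
  exact.
- by move=> x _; rewrite derive1E; exact: (@derive_val _ _ _ _ _ _ _ (dE x)).
Qed.

(** Squeezed between 0 and 1/x, because exp (x^2) >= 1 + x^2 > x^2. *)
Lemma cvg_mulr_gauss_fun (R : realType) :
  x * gauss_fun x @[x --> +oo] --> (0 : R).
Proof.
apply/(@squeeze_cvgr _ _ _ _ (fun=> 0) (fun x : R => x^-1)); last 2 first.
- exact: cvg_cst.
- by apply/gtr0_cvgV0; [exact: nbhs_pinfty_gt|exact: cvg_id].
near=> x.
have x0 : 0 < x by [].
rewrite mulr_ge0 ?gauss_fun_ge0 1?ltW//= /gauss_fun expRN.
rewrite ltr_pdivrMr ?expR_gt0// mulrC ltr_pdivlMr// -expr2.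
by apply: lt_le_trans (expR_ge1Dx _); rewrite ltrDr.
Unshelve. all: by end_near. Qed.

Lemma continuous_sqr_gauss_fun (R : realType) :
  continuous (fun x : R => x ^+ 2 * gauss_fun x).
Proof.
by move=> x; apply: cvgM; [exact: sqr_continuous|exact: continuous_gauss_fun].
Qed.

(** Integration by parts: - x exp (- x^2) vanishes at both ends and has derivative (2 x^2 - 1) exp
    (- x^2), so twice the integral is the Gaussian integral sqrt pi / 2. *)
Lemma integral0y_sqr_gauss (R : realType) :
  (\int[lebesgue_measure]_(x in `[0%R, +oo[) (x ^+ 2 * gauss_fun x)%:E =
   (Num.sqrt pi / 4)%:E :> \bar R)%E.
Proof.
set J := (X in X = _).
(* The term 2 * expR (- x) makes the derivative f of F nonnegative, as the
   half-line FTC requires; its own integral is subtracted at the end. *)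
pose f (x : R) := (2 * x ^+ 2 - 1) * gauss_fun x + 2 * expR (- x).
pose F (x : R) := - (x * gauss_fun x) - 2 * expR (- x).
(* Follows from exp (x^2 - x) >= 1 + x^2 - x >= 3/4. *)
have gle (x : R) : gauss_fun x <= 2 * expR (- x).
  rewrite /gauss_fun [X in _ * expR X](_ : - x = - x ^+ 2 + (x ^+ 2 - x));
    last by ring.
  rewrite expRD mulrCA ler_peMr ?expR_ge0//.
  have := expR_ge1Dx (x ^+ 2 - x); have := sqr_ge0 (x - 2^-1); nra.
have dF (x : R) : is_derive x 1 F (f x).
  rewrite /F /f /gauss_fun. apply: is_derive_eq.
  rewrite /GRing.scale/=. ring.
have f0 (x : R) : 0 <= f x.
  rewrite /f mulrBl mul1r -addrA addr_ge0//.
    by rewrite mulr_ge0 ?gauss_fun_ge0// mulr_ge0// sqr_ge0.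
  by rewrite addrC subr_ge0.
have intf : (\int[lebesgue_measure]_(x in `[0%R, +oo[) (f x)%:E = 2%:E)%E.
  rewrite (@ge0_continuous_FTC2y _ f F 0 0).
  - by rewrite /F mul0r oppr0 expR0 sub0r mulr1 sub0e EFinN oppeK.
  - by move=> x _; exact: f0.
  - apply: continuous_subspaceT => x.
    rewrite /f; apply: cvgD; apply: cvgM.
    + apply: cvgB; last exact: cvg_cst.
      by apply: cvgM; [exact: cvg_cst|exact: sqr_continuous].
    + exact: continuous_gauss_fun.
    + exact: cvg_cst.
    + apply: (cvg_comp _ expR); last exact: continuous_expR.
      by apply: cvgN; exact: cvg_id.
  - rewrite [X in _ --> X](_ : 0 = - 0 - 2 * 0);
      last by rewrite mulr0 subr0 oppr0.
    apply: cvgB; first by apply: cvgN; exact: cvg_mulr_gauss_fun.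
    by apply: cvgM; [exact: cvg_cst|exact: cvgr_expR].
  - by move=> x _; exact: (@ex_derive _ _ _ _ _ _ _ (dF x)).
  - apply: cvg_at_right_filter.
    have /derivable1_diffP/differentiable_continuous :=
      @ex_derive _ _ _ _ _ _ _ (dF 0).
    exact.
  - by move=> x _; rewrite derive1E; exact: (@derive_val _ _ _ _ _ _ _ (dF x)).
have mg : measurable_fun setT (fun x : R => x ^+ 2 * gauss_fun x).
  apply: measurable_funM; first exact: measurable_funX.
  exact: measurable_gauss_fun.
have me : measurable_fun setT (fun x : R => expR (- x)).
  by apply: measurableT_comp => //; exact: measurable_funN.
have mf : measurable_fun setT f.
  apply: measurable_funD; apply: measurable_funM => //.
    by apply: measurable_funB => //; apply: measurable_funM.
  exact: measurable_gauss_fun.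
pose I (h : R -> R) := (\int[lebesgue_measure]_(x in `[0%R, +oo[) (h x)%:E)%E.
have ID (g h : R -> R) : measurable_fun setT g -> measurable_fun setT h ->
    (forall x, 0 <= g x) -> (forall x, 0 <= h x) ->
    (I (fun x => g x + h x)%R = I g + I h)%E.
  move=> mg' mh g0 h0; rewrite /I -ge0_integralD//=.
  - by move=> x _; rewrite lee_fin.
  - by apply/measurable_EFinP; exact: measurable_funTS.
  - by move=> x _; rewrite lee_fin.
  - by apply/measurable_EFinP; exact: measurable_funTS.
have I2 (g : R -> R) : measurable_fun setT g -> (forall x, 0 <= g x) ->
    (I (fun x => g x + g x)%R = I g + I g)%E by move=> *; exact: ID.
have g0 (x : R) : 0 <= x ^+ 2 * gauss_fun x.
  by rewrite mulr_ge0 ?gauss_fun_ge0// sqr_ge0.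
have e0 (x : R) : 0 <= expR (- x) by exact: expR_ge0.
(* Adding the Gaussian to [f] leaves only nonnegative integrands, so integrals add up before J is
   known to be finite. *)
have : (I f + I gauss_fun = (J + J) + (1 + 1))%E.
  rewrite -[in RHS]integral0y_expRN -ID//; last 2 first.
  - exact: measurable_gauss_fun.
  - exact: gauss_fun_ge0.
  rewrite -!I2// -ID; last 4 first.
  - exact: measurable_funD.
  - exact: measurable_funD.
  - by move=> x; rewrite addr_ge0.
  - by move=> x; rewrite addr_ge0.
  by apply: eq_integral => x _; congr EFin; rewrite /f; ring.
rewrite /I intf integral0y_gauss.
have : (0 <= J)%E.
  by apply: integral_ge0 => x _; rewrite lee_fin.
by case: J => [r|//|//] r0 [] e; congr EFin; lra.
Qed.

Lemma integralT_sqr_gauss (R : realType) :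
  (\int[lebesgue_measure]_x (x ^+ 2 * gauss_fun x)%:E =
   (Num.sqrt pi / 2)%:E :> \bar R)%E.
Proof.
rewrite (@ge0_symfun_integralT _ (fun x => x ^+ 2 * gauss_fun x))//=.
- rewrite (_ : [set x | _] = `[0, +oo[%classic); last first.
    by apply/seteqP; split => x/=; rewrite in_itv/= andbT.
  by rewrite integral0y_sqr_gauss -EFinM; congr EFin; field.
- by move=> x; rewrite mulr_ge0 ?gauss_fun_ge0// sqr_ge0.
- exact: continuous_sqr_gauss_fun.
- by move=> x/=; rewrite /gauss_fun sqrrN.
Qed.

(** The substitution y = (x - m) / (s sqrt 2) reduces the variance to [integralT_sqr_gauss]. *)
Lemma integral_normal_pdf_sqr (R : realType) (m s : R) : 0 < s ->
  (\int[lebesgue_measure]_x ((x - m) ^+ 2 * normal_pdf m s x)%:E =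
   (s ^+ 2)%:E :> \bar R)%E.
Proof.
move=> s0; pose t := Num.sqrt (s ^+ 2 *+ 2).
have t0 : 0 < t by rewrite sqrtr_gt0 pmulrn_lgt0// exprn_gt0.
have tE : t ^+ 2 = s ^+ 2 *+ 2 by rewrite sqr_sqrtr// mulrn_wge0// sqr_ge0.
pose F (x : R) := (x - m) / t.
have dF (x : R) : is_derive x 1 F t^-1.
  by rewrite /F; apply: is_derive_eq; rewrite /GRing.scale/=; ring.
have F'E : F^`()%classic = cst t^-1.
  apply/funext => x; rewrite derive1E.
  exact: (@derive_val _ _ _ _ _ _ _ (dF x)).
have sp : 0 < Num.sqrt pi :> R by rewrite sqrtr_gt0 pi_gt0.
have := @integralT_sqr_gauss R.
rewrite (@increasing_ge0_integration_by_substitutionT _ F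
  (fun x => x ^+ 2 * gauss_fun x)); last first.
- by move=> x; rewrite mulr_ge0 ?gauss_fun_ge0// sqr_ge0.
- exact: continuous_sqr_gauss_fun.
- apply/gt0_cvgMly; last exact: cvg_addrr.
  by rewrite invr_gt0.
- apply/gt0_cvgMlNy; last exact: cvg_addrr_Ny.
  by rewrite invr_gt0.
- by move=> x; exact: (@ex_derive _ _ _ _ _ _ _ (dF x)).
- by rewrite F'E; exact: is_cvg_cst.
- by rewrite F'E; exact: is_cvg_cst.
- by rewrite F'E => ?; exact: cvg_cst.
- by move=> x y xy; rewrite /F ltr_pM2r ?invr_gt0// ltrD2r.
move=> H.
have E x : (((fun x => x ^+ 2 * gauss_fun x) \o F) * F^`()%classic) x =
    Num.sqrt pi / (2 * s ^+ 2) * ((x - m) ^+ 2 * normal_pdf m s x).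
  rewrite F'E normal_pdfE ?gt_eqF// /normal_fun /normal_peak !fctE/=.
  rewrite /F /gauss_fun -tE expr_div_n mulNr.
  rewrite (_ : Num.sqrt (s ^+ 2 * _ *+ 2) = Num.sqrt pi * t); last first.
    by rewrite -sqrtrM ?pi_ge0//; congr Num.sqrt; ring.
  rewrite (_ : 2 * s ^+ 2 = t ^+ 2); last by rewrite tE mulr2n; ring.
  field.
  by rewrite !gt_eqF.
move: H; under eq_integral do rewrite E EFinM.
rewrite ge0_integralZl//=; last 3 first.
- by apply/measurable_EFinP/measurable_funM;
    [exact/measurable_funX/measurable_funB|exact: measurable_normal_pdf].
- by move=> x _; rewrite lee_fin mulr_ge0 ?sqr_ge0 ?normal_pdf_ge0.
- by rewrite lee_fin divr_ge0 ?mulr_ge0 ?sqr_ge0 ?ltW.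
have : (0 <= \int[lebesgue_measure]_x
    ((x - m) ^+ 2 * normal_pdf m s x)%:E :> \bar R)%E.
  apply: integral_ge0 => x _.
  by rewrite lee_fin mulr_ge0 ?sqr_ge0 ?normal_pdf_ge0.
case: integral => [r|//|//] r0.
  move=> [] H; congr EFin; apply: (mulfI (lt0r_neq0 sp)).
  have s2 : s != 0 by rewrite gt_eqF.
  transitivity (Num.sqrt pi / (2 * s ^+ 2) * r * (2 * s ^+ 2)); first by field.
  by rewrite H; field.
by rewrite gt0_muley// lte_fin divr_gt0 ?mulr_gt0 ?exprn_gt0.
Qed.

(** * Tilted densities and integration against a normal law *)

Lemma expR_sqr_normal_pdf (R : realType) (m s k x : R) : 0 < s ->
  2 * k * s ^+ 2 < 1 ->
  expR (k * (x - m) ^+ 2) * normal_pdf m s x =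
  (Num.sqrt (1 - 2 * k * s ^+ 2))^-1 *
    normal_pdf m (s / Num.sqrt (1 - 2 * k * s ^+ 2)) x.
Proof.
move=> s0 ks; set u := 1 - _.
have u0 : 0 < u by rewrite subr_gt0.
have su0 : 0 < Num.sqrt u by rewrite sqrtr_gt0.
have s20 : s ^+ 2 != 0 by rewrite sqrf_eq0 gt_eqF.
have u20 : Num.sqrt u ^+ 2 = u by rewrite sqr_sqrtr// ltW.
rewrite !normal_pdfE ?gt_eqF ?divr_gt0// /normal_fun /normal_peak.
rewrite expr_div_n u20 mulrCA -expRD mulrA; congr (_ * expR _).
  rewrite -invfM -sqrtrM ?ltW//; congr (Num.sqrt _)^-1.
  by field; rewrite gt_eqF.
have ks2 : k = (1 - u) / (2 * s ^+ 2).
  by rewrite /u; field; rewrite -sqrf_eq0.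
by rewrite ks2; field; rewrite gt_eqF// -sqrf_eq0.
Qed.

(** [normal_pdf] and the Radon-Nikodym derivative have equal integrals over every measurable set,
    hence agree almost everywhere. *)
Lemma ge0_integral_normal_prob (R : realType) (m s : R) (f : R -> \bar R) :
  measurable_fun setT f -> (forall x, 0 <= f x)%E ->
  (\int[normal_prob m s]_x f x =
   \int[lebesgue_measure]_x (f x * (normal_pdf m s x)%:E))%E.
Proof.
move=> mf f0.
have dom := normal_prob_dominates m s.
have RNi := Radon_Nikodym_SigmaFinite.f_integrable dom.
rewrite -(Radon_Nikodym_SigmaFinite.change_of_variables dom)//.
have mpdf : measurable_fun setT (fun x => (normal_pdf m s x)%:E).
  by apply/measurable_EFinP; exact: measurable_normal_pdf.
apply: ae_eq_integral => //.
- by apply: emeasurable_funM => //; exact: measurable_int RNi.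
- exact: emeasurable_funM.
- apply: ae_eqe_mul2l; apply: integral_ae_eq => //.
  by move=> E _ mE; rewrite -Radon_Nikodym_SigmaFinite.f_integral.
Qed.

Lemma ge0_integral_normal_law d (T : measurableType d) (R : realType)
    (P : probability T R) (W : T -> R) (m s : R) (f : R -> R) :
  measurable_fun setT W ->
  (forall B, measurable B -> P (W @^-1` B) = normal_prob m s B) ->
  measurable_fun setT f -> (forall x, 0 <= f x) ->
  (\int[P]_w (f (W w))%:E =
   \int[lebesgue_measure]_x (f x * normal_pdf m s x)%:E)%E.
Proof.
move=> mW lawW mf f0.
have mEf : measurable_fun setT (EFin \o f) by apply/measurable_EFinP.
have f0' (x : R) : (0 <= (EFin \o f) x)%E by rewrite lee_fin.
pose W' : {mfun T >-> measurableTypeR R} :=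
  HB.pack W (isMeasurableFun.Build _ _ T (measurableTypeR R) W mW).
transitivity (\int[distribution P W']_x (EFin \o f) x)%E.
  by rewrite ge0_integral_distribution.
transitivity (\int[normal_prob m s]_x (EFin \o f) x)%E.
  by apply: eq_measure_integral => A mA _; exact: lawW.
by rewrite ge0_integral_normal_prob.
Qed.

(** * Scalars as one-by-one matrices, and linear forms *)

Lemma scalar_ofD (R : realType) (M N : 'M[R]_1) :
  scalar_of (M + N) = scalar_of M + scalar_of N.
Proof. by rewrite /scalar_of mxE. Qed.

Lemma scalar_ofN (R : realType) (M : 'M[R]_1) : scalar_of (- M) = - scalar_of M.
Proof. by rewrite /scalar_of mxE. Qed.

Lemma scalar_ofZ (R : realType) (k : R) (M : 'M[R]_1) :
  scalar_of (k *: M) = k * scalar_of M.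
Proof. by rewrite /scalar_of mxE. Qed.

Lemma scalar_of_mul (R : realType) (M N : 'M[R]_1) :
  scalar_of (M *m N) = scalar_of M * scalar_of N.
Proof. by rewrite /scalar_of mxE big_ord1. Qed.

Lemma scalar_of_tr (R : realType) (M : 'M[R]_1) : scalar_of M^T = scalar_of M.
Proof. by rewrite /scalar_of mxE. Qed.

(** The quadratic term is a scalar times its own transpose, so the risk depends on X only through
    the real variable a^T X, whose law is known. *)
Lemma VGXE (R : realType) (n : nat) (gamma : R) (mu a x : 'cV[R]_n) :
  VGX gamma mu a x =
  gamma / 2 * (scalar_of (a^T *m x) - scalar_of (a^T *m mu)) ^+ 2
  - scalar_of (a^T *m mu).
Proof.
rewrite /VGX -mulmxA scalar_of_mul -[X in _ * (_ * X) - _]scalar_of_tr.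
by rewrite trmx_mul trmxK mulmxBr scalar_ofD scalar_ofN -expr2.
Qed.

Lemma measurable_linear_form d (T : measurableType d) (R : realType) (n : nat)
    (X : T -> 'cV[R]_n) (a : 'cV[R]_n) :
  (forall i, measurable_fun setT (fun w => X w i 0)) ->
  measurable_fun setT (fun w => scalar_of (a^T *m X w)).
Proof.
move=> mX; under eq_fun do rewrite /scalar_of mxE.
by apply: measurable_sum => i; apply: measurable_funM.
Qed.

Lemma ln_sqrt (R : realType) (x : R) : 0 < x -> ln (Num.sqrt x) = ln x / 2.
Proof.
move=> x0; rewrite -[in RHS](sqr_sqrtr (ltW x0)) lnXn ?sqrtr_gt0//.
by rewrite -[_ *+ 2]mulr_natr mulfK.
Qed.

(** Gives access to [gaussian_vector] and [symmetric_posdef], which speak of nonzero vectors. *)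
Lemma portfolio_neq0 (R : realType) (n : nat) (a : 'cV[R]_n) :
  portfolios a -> a != 0.
Proof.
move=> ha; apply/eqP => a0; move: ha.
rewrite a0 /portfolios/= trmx0 mul0mx /scalar_of mxE => /eqP.
by rewrite eq_sym oner_eq0.
Qed.

(** * Exponential moment, risk and relative entropy of a fixed portfolio *)

Section gaussian_portfolio.
Context d (T : measurableType d) (R : realType) (P : probability T R).
Context (n : nat) (mu : 'cV[R]_n) (Sigma : 'M[R]_n) (X : T -> 'cV[R]_n).
Context (hSigma : symmetric_posdef Sigma) (hX : gaussian_vector P X mu Sigma).
Context (gamma theta : R) (a : 'cV[R]_n) (hdom : domain gamma Sigma (theta, a)).
Context (hgamma : 0 < gamma).

Let m := scalar_of (a^T *m mu).
Let v := scalar_of (a^T *m Sigma *m a).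
Let W (w : T) := scalar_of (a^T *m X w).
Let u := 1 - theta * gamma * v.

Let a0 : a != 0. Proof. by case: hdom => _ /portfolio_neq0. Qed.

Let v0 : 0 < v. Proof. exact: hSigma.2. Qed.

Let theta0 : 0 < theta. Proof. by case: hdom. Qed.

Let thv : theta * v < 1 / gamma. Proof. by case: hdom. Qed.

Lemma one_sub_variance_gt0 : 0 < u.
Proof.
by rewrite subr_gt0 mulrAC -ltr_pdivlMr// thv.
Qed.

Let su0 : 0 < Num.sqrt u. Proof. by rewrite sqrtr_gt0 one_sub_variance_gt0. Qed.

Let mW : measurable_fun setT W.
Proof. exact: measurable_linear_form hX.1. Qed.

Let lawW B : measurable B -> P (W @^-1` B) = normal_prob m (Num.sqrt v) B.
Proof. exact: hX.2. Qed.

Let sv0 : 0 < Num.sqrt v. Proof. by rewrite sqrtr_gt0. Qed.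

(** Matches [expR_sqr_normal_pdf] with k = theta gamma / 2 and s^2 = v. *)
Let tiltE : 1 - 2 * (theta * gamma / 2) * Num.sqrt v ^+ 2 = u.
Proof. by rewrite sqr_sqrtr ?ltW// /u; field. Qed.

Let tilt_lt1 : 2 * (theta * gamma / 2) * Num.sqrt v ^+ 2 < 1.
Proof. by rewrite -subr_gt0 tiltE one_sub_variance_gt0. Qed.

Let g (x : R) := expR (theta * gamma / 2 * (x - m) ^+ 2).

Let mg : measurable_fun setT g.
Proof.
apply: measurableT_comp => //; apply: measurable_funM => //.
by apply: measurable_funX; exact: measurable_funB.
Qed.

Let integral_g : (\int[P]_w (g (W w))%:E = ((Num.sqrt u)^-1)%:E)%E.
Proof.
rewrite (ge0_integral_normal_law mW lawW mg) => [|x]; last exact: expR_ge0.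
under eq_integral do rewrite /g expR_sqr_normal_pdf// tiltE EFinM.
rewrite ge0_integralZl//=.
- by rewrite integral_normal_pdf mule1.
- by apply/measurable_EFinP; exact: measurable_normal_pdf.
- by move=> x _; rewrite lee_fin normal_pdf_ge0.
Qed.

Let integral_g_sqr :
  (\int[P]_w (g (W w) * (W w - m) ^+ 2)%:E = ((Num.sqrt u)^-1 * (v / u))%:E)%E.
Proof.
rewrite (ge0_integral_normal_law mW lawW (f := fun x => g x * (x - m) ^+ 2));
  last 2 first.
- apply: measurable_funM => //; apply: measurable_funX.
  exact: measurable_funB.
- by move=> x; rewrite mulr_ge0 ?expR_ge0 ?sqr_ge0.
transitivity (\int[lebesgue_measure]_x ((Num.sqrt u)^-1%:E *
    ((x - m) ^+ 2 * normal_pdf m (Num.sqrt v / Num.sqrt u) x)%:E))%E.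
  apply: eq_integral => x _; rewrite -EFinM; congr EFin.
  rewrite /g mulrAC expR_sqr_normal_pdf// tiltE -mulrA; congr (_ * _).
  exact: mulrC.
rewrite ge0_integralZl//=.
- rewrite integral_normal_pdf_sqr ?divr_gt0// -EFinM; congr (_ * _)%:E.
  by rewrite expr_div_n !sqr_sqrtr ?ltW// one_sub_variance_gt0.
- by apply/measurable_EFinP/measurable_funM;
    [exact/measurable_funX/measurable_funB|exact: measurable_normal_pdf].
- by move=> x _; rewrite lee_fin mulr_ge0 ?normal_pdf_ge0// sqr_ge0.
Qed.

Let expVE w :
  expR (theta * VGX gamma mu a (X w)) = expR (- (theta * m)) * g (W w).
Proof. by rewrite VGXE -expRD; congr expR; rewrite /W/m; field. Qed.

Lemma exp_moment_gaussian :
  exp_moment P X mu gamma theta a = (expR (- (theta * m)) / Num.sqrt u)%:E.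
Proof.
rewrite /exp_moment unlock; under eq_integral do rewrite expVE EFinM.
rewrite ge0_integralZl//=.
- by rewrite integral_g -EFinM.
- by apply/measurable_EFinP; exact: measurableT_comp.
- by move=> w _; rewrite lee_fin expR_ge0.
Qed.

Lemma entropic_risk_gaussian :
  entropic_risk P X mu gamma theta a = (- m - ln u / (2 * theta))%:E.
Proof.
rewrite /entropic_risk exp_moment_gaussian lne_EFin ?divr_gt0 ?expR_gt0//.
rewrite -EFinM ln_div ?posrE ?expR_gt0// expRK ln_sqrt ?one_sub_variance_gt0//.
by congr EFin; field; rewrite gt_eqF.
Qed.

(** The logarithm of the density is ln u / 2 + theta gamma (W - m)^2 / 2, and (W - m)^2 has mean v /
    u under the tilted law; theta gamma v = 1 - u finishes. *)
Lemma relative_entropy_gaussian :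
  relative_entropy P (change_of_measure P X mu gamma theta a) =
  (1 / 2 * (u^-1 - 1 - ln u^-1))%:E.
Proof.
have cE w : change_of_measure P X mu gamma theta a w = Num.sqrt u * g (W w).
  rewrite /change_of_measure exp_moment_gaussian expVE/=.
  by field; rewrite !gt_eqF ?expR_gt0.
have lnE w : ln (Num.sqrt u * g (W w)) =
    ln u / 2 + theta * gamma / 2 * (W w - m) ^+ 2.
  by rewrite lnM ?posrE ?expR_gt0// expRK ln_sqrt ?one_sub_variance_gt0.
rewrite /relative_entropy unlock.
pose k1 := Num.sqrt u * (ln u / 2); pose k2 := Num.sqrt u * (theta * gamma / 2).
(* The integrand of the entropy has no constant sign (ln u < 0), so splitting it needs
   integrability. *)
have i1 : P.-integrable setT (fun w => (g (W w))%:E).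
  apply/integrableP; split.
    by apply/measurable_EFinP; exact: measurableT_comp.
  under eq_integral do rewrite /= ger0_norm ?expR_ge0//.
  by rewrite integral_g ltry.
have i2 : P.-integrable setT (fun w => (g (W w) * (W w - m) ^+ 2)%:E).
  apply/integrableP; split.
    apply/measurable_EFinP; apply: measurable_funM.
      exact: measurableT_comp.
    by apply: measurable_funX; exact: measurable_funB.
  have gW0 w : 0 <= g (W w) * (W w - m) ^+ 2.
    by rewrite mulr_ge0 ?expR_ge0 ?sqr_ge0.
  under eq_integral do rewrite abse_EFin ger0_norm//.
  by rewrite integral_g_sqr ltry.
transitivity (\int[P]_w
    (k1%:E * (g (W w))%:E + k2%:E * (g (W w) * (W w - m) ^+ 2)%:E))%E.
  apply: eq_integral => w _; rewrite cE lnE -!EFinM -EFinD; congr EFin.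
  by rewrite /k1 /k2; ring.
rewrite integralD//=; [|exact: integrableZl|exact: integrableZl].
rewrite !integralZl// integral_g integral_g_sqr -!EFinM -EFinD; congr EFin.
rewrite lnV ?posrE ?one_sub_variance_gt0// /k1 /k2.
have u0 := lt0r_neq0 one_sub_variance_gt0.
have thvE : theta * gamma * v = 1 - u by rewrite /u; ring.
transitivity (ln u / 2 + theta * gamma * v / u / 2).
  by field; rewrite u0 gt_eqF.
by rewrite thvE; field.
Qed.

End gaussian_portfolio.

(** * Minimisation over portfolios at fixed theta *)

Section minimiser.
Context (R : realType) (n : nat) (hn : (1 <= n)%N).
Context (mu : 'cV[R]_n) (Sigma : 'M[R]_n) (hSigma : symmetric_posdef Sigma).

Let dot (x y : 'cV[R]_n) := scalar_of (x^T *m y).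
Let bil (x y : 'cV[R]_n) := scalar_of (x^T *m Sigma *m y).
Let dual (z : 'cV[R]_n) := invmx Sigma *m z.
Let A := constA mu Sigma.
Let B := constB mu Sigma.
Let C := constC Sigma.
Let D := constD mu Sigma.

Let dotC x y : dot x y = dot y x.
Proof. by rewrite /dot -[RHS]scalar_of_tr trmx_mul trmxK. Qed.

Let dotDr x y z : dot x (y + z) = dot x y + dot x z.
Proof. by rewrite /dot mulmxDr scalar_ofD. Qed.

Let dotZr k x y : dot x (k *: y) = k * dot x y.
Proof. by rewrite /dot -scalemxAr scalar_ofZ. Qed.

(** A row x with x Sigma = 0 satisfies x Sigma x^T = 0, hence vanishes. *)
Lemma posdef_unitmx : Sigma \in unitmx.
Proof.
rewrite -row_free_unit; apply: inj_row_free => x xS.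
apply/eqP; apply: contraT => x0.
have := hSigma.2 x^T; rewrite trmxK xS mul0mx /scalar_of mxE ltxx.
apply; apply: contra x0 => /eqP x0.
by rewrite -[x]trmxK x0 trmx0.
Qed.

Let bilC x y : bil x y = bil y x.
Proof.
by rewrite /bil -[RHS]scalar_of_tr !trmx_mul trmxK hSigma.1 mulmxA.
Qed.

Let bilB x y : bil (x - y) (x - y) = bil x x - 2 * bil x y + bil y y.
Proof.
have bDr z : bil z (x - y) = bil z x - bil z y.
  by rewrite /bil mulmxBr scalar_ofD scalar_ofN.
by rewrite bDr !(bilC (x - y)) !bDr (bilC y x); ring.
Qed.

Let bil_ge0 x : 0 <= bil x x.
Proof.
have [->|x0] := eqVneq x 0; last exact/ltW/hSigma.2.
by rewrite /bil mulmx0 /scalar_of mxE.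
Qed.

Let bil_dual x z : bil x (dual z) = dot x z.
Proof.
by rewrite /bil /dual /dot mulmxA mulmxK // posdef_unitmx.
Qed.

Let dot_dual x y : dot x (dual y) = scalar_of (x^T *m invmx Sigma *m y).
Proof. by rewrite /dot /dual mulmxA. Qed.

Let dual_sym x y : dot x (dual y) = dot y (dual x).
Proof. by rewrite dotC -bil_dual bilC bil_dual dotC. Qed.

Let dotA : dot mu (dual ones) = A.
Proof. by rewrite dual_sym dot_dual. Qed.

Let dotA' : dot ones (dual mu) = A.
Proof. by rewrite dot_dual. Qed.

Let dotB : dot mu (dual mu) = B.
Proof. by rewrite dot_dual. Qed.

Let dot_ones : dot ones (dual ones) = C.
Proof. by rewrite dot_dual. Qed.

Let dualD x y : dual (x + y) = dual x + dual y.
Proof. exact: mulmxDr. Qed.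

Let dualZ k x : dual (k *: x) = k *: dual x.
Proof. by rewrite /dual scalemxAr. Qed.

(** C is the squared Sigma-norm of Sigma^-1 1, which is nonzero as n >= 1. *)
Lemma constC_gt0 : 0 < C.
Proof.
rewrite -dot_ones dotC -bil_dual; apply: hSigma.2.
apply/eqP => /(congr1 (mulmx Sigma)).
rewrite /dual mulmxA mulmxV ?posdef_unitmx// mul1mx mulmx0.
move/matrixP => /(_ (Ordinal hn) 0); rewrite !mxE => /eqP.
by rewrite oner_eq0.
Qed.

(** Cauchy-Schwarz for Sigma^-1: C D is the squared Sigma-norm of Sigma^-1 (C mu - A 1). *)
Lemma constD_ge0 : 0 <= D.
Proof.
have := bil_ge0 (dual (C *: mu - A *: ones)).
rewrite bil_dual dotC -scaleNr dualD !dualZ dotDr !dotZr.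
rewrite !(dotC (_ + _)) !dotDr !dotZr !(dotC (dual _)) dotB dotA dotA' dot_ones.
rewrite (_ : _ + _ = C * D); last by rewrite /D /constD -/A -/B -/C; ring.
by rewrite pmulr_rge0// constC_gt0.
Qed.

(** C^-1 Sigma^-1 1 is the minimum-variance portfolio; the gap is the squared Sigma-norm of b minus
    it. *)
Lemma portfolio_variance_ge (b : 'cV[R]_n) : portfolios b -> 1 / C <= bil b b.
Proof.
move=> hb; have C0 := constC_gt0; have := bil_ge0 (b - dual (C^-1 *: ones)).
rewrite bilB !bil_dual !dotZr (dotC (dual _)) dualZ dotZr dot_ones.
rewrite (_ : dot b ones = 1)//.
rewrite (_ : _ + _ = bil b b - 1 / C) ?subr_ge0//.
by field; rewrite gt_eqF.
Qed.

Context (gamma theta : R) (hgamma : 0 < gamma) (htheta : 0 < theta).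

(** [GammaGX] is the quadratic formula with the plus sign; [constD_ge0] makes the discriminant
    nonnegative. *)
Lemma GammaGX_root : theta * gamma < C ->
  let G := GammaGX mu Sigma theta gamma in
  0 < G /\ (C - theta * gamma) * G ^+ 2 = gamma * C * G + theta * gamma * D.
Proof.
move=> hC G; have C0 := constC_gt0; have D0 := constD_ge0.
have E0 : 0 < C - theta * gamma by rewrite subr_gt0.
pose r := Num.sqrt
  (gamma ^+ 2 * C ^+ 2 + 4 * theta * gamma * (C - theta * gamma) * D).
have rE : r ^+ 2 =
    gamma ^+ 2 * C ^+ 2 + 4 * theta * gamma * (C - theta * gamma) * D.
  rewrite sqr_sqrtr// -exprMn addr_ge0 ?sqr_ge0//.
  by apply: mulr_ge0 => //; rewrite !mulr_ge0// ltW.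
have GE : G = (gamma * C + r) / (2 * (C - theta * gamma)) by [].
split.
  rewrite GE divr_gt0 ?mulr_gt0// ltr_pwDl ?mulr_gt0//.
  exact: sqrtr_ge0.
have rG : r = 2 * (C - theta * gamma) * G - gamma * C.
  by rewrite GE; field; rewrite gt_eqF.
move: rE; rewrite rG => rE; apply: (mulfI (lt0r_neq0 E0)).
apply: (@mulfI _ 4) => //; move: rE; lra.
Qed.

(** The inequality is strict so that the minimiser is unique and can be identified with [astar]. *)
Lemma risk_minimiser : (exists b, domain gamma Sigma (theta, b)) ->
  exists2 a : 'cV[R]_n, domain gamma Sigma (theta, a) &
    1 - theta * gamma * bil a a = gamma / GammaGX mu Sigma theta gamma /\
    forall b, domain gamma Sigma (theta, b) -> b != a ->
      - dot a mu - ln (1 - theta * gamma * bil a a) / (2 * theta) <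
      - dot b mu - ln (1 - theta * gamma * bil b b) / (2 * theta).
Proof.
case=> b0 [_ hb0 vb0]; have C0 := constC_gt0.
(* Even the least variance 1 / C must satisfy the domain constraint. *)
have hC : theta * gamma < C.
  have := portfolio_variance_ge hb0.
  rewrite -(ler_pM2l htheta) => /le_lt_trans/(_ vb0).
  by rewrite mulrA mulr1 ltr_pdivrMr// mulrAC mul1r ltr_pdivlMr.
have [] := GammaGX_root hC; set G := GammaGX _ _ _ _; move: G => G G0 GE.
(* Stationarity under the budget constraint reads (gamma / u) Sigma a = mu + k 1, with G in the role
   of gamma / u; a^T 1 = 1 becomes A + k C = G. *)
pose k := (G - A) / C; pose a := G^-1 *: dual (mu + k *: ones).
have bila b : bil b a = G^-1 * (dot b mu + k * dot b ones).
  by rewrite /a -dualZ bil_dual dotZr dotDr dotZr.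
have dota x : dot a x = G^-1 * (dot x (dual mu) + k * dot x (dual ones)).
  by rewrite dotC /a dotZr dualD dualZ dotDr dotZr.
have ha : dot a ones = 1.
  by rewrite dota dotA' dot_ones /k; field; rewrite !gt_eqF.
(* The variance of a is 1 / C + D / (C G^2); the quadratic equation for G then gives u. *)
have ua : 1 - theta * gamma * bil a a = gamma / G.
  rewrite bila ha dota dotB dotA mulr1.
  have BE : B = (D + A ^+ 2) / C.
    by rewrite /D /constD -/A -/B -/C; field; rewrite gt_eqF.
  have DE : D = ((C - theta * gamma) * G ^+ 2 - gamma * C * G) / (theta * gamma).
    by rewrite GE; field; rewrite !gt_eqF.
  by rewrite BE DE /k; field; rewrite !gt_eqF.
exists a.
  split => //=; rewrite ltr_pdivlMr// mulrAC -subr_gt0 ua divr_gt0//.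
split => // b [_ hb vb] ba; rewrite ua.
have ub0 : 0 < 1 - theta * gamma * bil b b.
  by rewrite subr_gt0 mulrAC -ltr_pdivlMr.
set ub := 1 - _ in ub0 *.
have bba : 0 < bil (b - a) (b - a) by apply: hSigma.2; rewrite subr_eq0.
(* The multiplier k cancels because both vectors meet the budget. *)
have dba : bil b a - bil a a = G^-1 * (dot b mu - dot a mu).
  by rewrite !bila ha (_ : dot b ones = 1)//; ring.
have lnle : ln ub - ln (gamma / G) <= ub * (G / gamma) - 1.
  have -> : ln ub - ln (gamma / G) = ln (ub * (G / gamma)).
    by rewrite -[G / gamma]invf_div [RHS]ln_div ?posrE ?divr_gt0.
  have x0 : 0 < ub * (G / gamma) by rewrite mulr_gt0 ?divr_gt0.
  have := expR_ge1Dx (ln (ub * (G / gamma))).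
  by rewrite lnK ?posrE//; lra.
rewrite -subr_gt0.
(* The excess risk is exactly the gap in ln x <= x - 1, over 2 theta, plus a quadratic term that is
   positive for b != a. *)
have -> : - dot b mu - ln ub / (2 * theta) -
    (- dot a mu - ln (gamma / G) / (2 * theta)) =
   (2 * theta)^-1 * (ub * (G / gamma) - 1 - (ln ub - ln (gamma / G))) +
   G / 2 * bil (b - a) (b - a).
  rewrite bilB.
  have bbE : bil b b = (1 - ub) / (theta * gamma).
    by rewrite /ub; field; rewrite !gt_eqF.
  have aaE : bil a a = (1 - gamma / G) / (theta * gamma).
    by rewrite -ua; field; rewrite !gt_eqF.
  have baE : bil b a = bil a a + G^-1 * (dot b mu - dot a mu) by lra.
  by rewrite baE bbE aaE; field; rewrite !gt_eqF.
apply: ltr_wpDl; last by rewrite mulr_gt0 ?divr_gt0.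
by rewrite mulr_ge0 ?invr_ge0 ?subr_ge0// mulr_ge0 ?ltW.
Qed.

End minimiser.

(** Here c stands for gamma a^T Sigma a with a frozen, which leaves a minimum problem in one real
    variable. *)
Lemma lagrangian_first_order (R : realType) (c m eta theta0 : R) :
  0 < c -> 0 < theta0 -> theta0 * c < 1 ->
  (forall t, 0 < t -> t * c < 1 ->
    - m - ln (1 - theta0 * c) / (2 * theta0) + eta / theta0 <=
    - m - ln (1 - t * c) / (2 * t) + eta / t) ->
  1 / 2 * ((1 - theta0 * c)^-1 - 1 - ln (1 - theta0 * c)^-1) = eta.
Proof.
move=> c0 theta00 thetac hmin.
have u0 : 0 < 1 - theta0 * c by rewrite subr_gt0.
(* Clearing the denominator t turns minimality of the Lagrangian into
   nonnegativity of h, which vanishes at theta0. *)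
pose K := (eta - ln (1 - theta0 * c) / 2) / theta0.
pose h (t : R) := eta - ln (1 - t * c) / 2 - t * K.
have dh t : t * c < 1 -> is_derive t 1 h (c / (2 * (1 - t * c)) - K).
  move=> tc; have u1 : 0 < 1 - t * c by rewrite subr_gt0.
  have dln : is_derive t 1 (fun t => ln (1 - t * c)) ((1 - t * c)^-1 * (- c)).
    apply: (@is_derive1_comp _ (@ln R) (fun t => 1 - t * c)).
      exact: is_derive1_ln.
    by apply: is_derive_eq; rewrite /GRing.scale/=; ring.
  rewrite /h; apply: is_derive_eq; rewrite /GRing.scale/=.
  by field; rewrite gt_eqF.
have h0 : h theta0 = 0 by rewrite /h /K; field; rewrite gt_eqF.
have dh0 : is_derive theta0 1 h 0.
  (* The constraints t > 0 and t c < 1 describe the open interval from 0 to 1 / c, so the minimum is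
     interior. *)
  apply: (@derive1_at_min _ h 0 c^-1).
  - by rewrite invr_ge0 ltW.
  - move=> t; rewrite in_itv/= => /andP[_ tc].
    apply: (@ex_derive _ _ _ _ _ _ _ (dh t _)).
    by rewrite -ltr_pdivlMr// mul1r.
  - by rewrite in_itv/= theta00 -[c^-1]mul1r ltr_pdivlMr.
  - move=> t; rewrite in_itv/= -[c^-1]mul1r ltr_pdivlMr// => /andP[t0 tc].
    rewrite h0 -(pmulr_lge0 (h t) (_ : 0 < t^-1)) ?invr_gt0//.
    have := hmin _ t0 tc; rewrite -subr_ge0; congr (_ <= _).
    by rewrite /h /K; field; rewrite !gt_eqF.
have := @derive_val _ _ _ _ _ _ _ dh0.
rewrite (@derive_val _ _ _ _ _ _ _ (dh _ thetac)) => /eqP.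
rewrite subr_eq0 => /eqP KE.
(* The vanishing derivative gives K = c / (2 u) with u = 1 - theta0 c; multiplying by theta0 brings
   eta back. *)
have : eta - ln (1 - theta0 * c) / 2 = c * theta0 / (2 * (1 - theta0 * c)).
  transitivity (K * theta0); first by rewrite /K divfK ?gt_eqF.
  by rewrite -KE; field; rewrite gt_eqF.
rewrite lnV ?posrE//; move=> E.
have -> : eta = ln (1 - theta0 * c) / 2 + c * theta0 / (2 * (1 - theta0 * c)).
  by lra.
by field; rewrite gt_eqF.
Qed.

Theorem proposition10 (d : measure_display) (T : measurableType d)
    (R : realType) (P : probability T R) (n : nat) (hn : (1 <= n)%N)
    (mu : 'cV[R]_n) (Sigma : 'M[R]_n) (hSigma : symmetric_posdef Sigma)
    (gamma : R) (hgamma : 0 < gamma)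
    (X : T -> 'cV[R]_n) (hX : gaussian_vector P X mu Sigma)
    (eta : R) (heta : 0 < eta)
    (thetastar : R) (hthetastar : 0 < thetastar)
    (hdom : domain gamma Sigma
              (thetastar, astar P X mu Sigma gamma thetastar))
    (hopt : inner_value P X mu Sigma gamma eta thetastar =
            outer_value P X mu Sigma gamma eta) :
  worst_case_entropy P X mu Sigma gamma thetastar = eta%:E /\
  (forall theta : R, 0 < theta ->
     (exists a : 'cV[R]_n, domain gamma Sigma (theta, a)) ->
     worst_case_entropy P X mu Sigma gamma theta =
     (1 / 2 * (GammaGX mu Sigma theta gamma / gamma - 1
               - ln (GammaGX mu Sigma theta gamma / gamma)))%:E).
Proof.
have astarP theta : 0 < theta -> (exists a, domain gamma Sigma (theta, a)) ->
    let a := astar P X mu Sigma gamma theta in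
    is_minimiser P X mu Sigma gamma theta a /\
    1 - theta * gamma * scalar_of (a^T *m Sigma *m a) =
      gamma / GammaGX mu Sigma theta gamma.
  move=> theta0 exa.
  have [a da [ua amin]] := risk_minimiser hn mu hSigma hgamma theta0 exa.
  have aP : is_minimiser P X mu Sigma gamma theta a.
    split=> // b db; have [->//|ba] := eqVneq b a.
    by rewrite !(entropic_risk_gaussian hSigma hX) // lee_fin ltW// amin.
  have sP : is_minimiser P X mu Sigma gamma theta
      (astar P X mu Sigma gamma theta).
    (* The existing minimiser a rules out the default value 0 of [xget]; strictness then forces
       [astar] to equal a. *)
    by rewrite /astar; case: xgetP => [b _ //|/(_ a)].
  split=> //; have [->//|sa] := eqVneq (astar P X mu Sigma gamma theta) a.
  have := sP.2 _ da.
  rewrite !(entropic_risk_gaussian hSigma hX) //; last exact: sP.1.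
  by rewrite lee_fin leNgt amin//; exact: sP.1.
split; last first.
  move=> theta theta0 exa; have [sP uE] := astarP _ theta0 exa.
  rewrite /worst_case_entropy (relative_entropy_gaussian hSigma hX) //;
    last exact: sP.1.
  by rewrite uE invf_div.
have [[_ smin] _] := astarP _ hthetastar
  (ex_intro (fun a => domain gamma Sigma (thetastar, a)) _ hdom).
rewrite /worst_case_entropy (relative_entropy_gaussian hSigma hX hdom)//.
(* From here a is frozen: it stays the same while theta varies. *)
move: (astar P X mu Sigma gamma thetastar) hdom smin => a hdom smin.
have [_ pa va] := hdom.
set v := scalar_of _ in va *.
have v0 : 0 < v by apply: hSigma.2; exact: portfolio_neq0.
rewrite -(mulrA thetastar).
congr EFin; apply: (@lagrangian_first_order _ _ (scalar_of (a^T *m mu))) => //.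
- by rewrite mulr_gt0.
- by rewrite mulrCA mulrC -ltr_pdivlMr.
move=> t t0 tv.
have dt : domain gamma Sigma (t, a).
  by split=> //=; rewrite ltr_pdivlMr// -mulrA [_ * gamma]mulrC.
have LE (th : R) : domain gamma Sigma (th, a) -> LGX P X mu gamma eta th a =
    (- scalar_of (a^T *m mu) - ln (1 - th * (gamma * v)) / (2 * th)
     + eta / th)%:E.
  by move=> dth; rewrite /LGX (entropic_risk_gaussian hSigma hX dth)// mulrA.
rewrite -lee_fin -!LE//.
(* The chain is L(thetastar, a) <= inner value at thetastar = outer value <= inner value at t <=
   L(t, a). *)
apply: (@le_trans _ _ (inner_value P X mu Sigma gamma eta thetastar)).
  by apply: le_ereal_inf_tmp => _ [b db <-]; rewrite /LGX leeD2r// smin.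
rewrite hopt; apply: (@le_trans _ _ (inner_value P X mu Sigma gamma eta t)).
  by apply: ereal_inf_lbound; exists t.
by apply: ereal_inf_lbound; exists a.
Qed.
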